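(* For a paracompact space $X$ the games $G_{ufin}(\mathcal{O},\Omega)$ and $SG_{comp}^*(\mathcal{O},\Omega)$ on $X$ are equivalent.
   Context: A space is paracompact if every open cover of it has a locally finite open refinement covering the space (no separation axiom is included; the Hausdorff property is mentioned separately when assumed). For a subset $A$ of $X$ and a collection $\mathcal{P}$ of subsets of $X$, $St(A,\mathcal{P})=\bigcup\{B\in\mathcal{P}: A\cap B\neq\emptyset\}$. An open cover $\mathcal{U}$ of $X$ is an $\omega$-cover if each finite $F\subseteq X$ is contained in some $U\in\mathcal{U}$ (the set $X$ itself is allowed to be a member). $\mathcal{O}$ and $\Omega$ denote the collections of all open covers and all $\omega$-covers of $X$. The games are played by ONE and TWO with one inning for each positive integer $n$; in the $n$th inning ONE first chooses an open cover $\mathcal{U}_n$ of $X$, then TWO responds. In $G_{ufin}(\mathcal{O},\Omega)$ TWO responds with a finite $\mathcal{V}_n\subseteq\mathcal{U}_n$, and TWO wins the play if $\{\bigcup\mathcal{V}_n: n\in\mathbb{N}\}$ is an $\omega$-cover of $X$ or $\bigcup\mathcal{V}_n=X$ for some $n$; otherwise ONE wins. In $SG_{comp}^*(\mathcal{O},\Omega)$ TWO responds with a compact subset $K_n$ of $X$, and TWO wins the play if $\{St(K_n,\mathcal{U}_n): n\in\mathbb{N}\}$ is an $\omega$-cover of $X$; otherwise ONE wins. Two games are equivalent if whenever one of the players has a winning strategy in one of the games, that same player has a winning strategy in the other game. *)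

(* Defs.v *)
From HB Require Import structures.
From mathcomp Require Import all_boot all_order.
From mathcomp Require Import boolp classical_sets functions cardinality.
From mathcomp Require Import topology.

Set Implicit Arguments.
Unset Strict Implicit.
Unset Printing Implicit Defensive.

Local Open Scope classical_set_scope.

Section Covers.
Variable X : topologicalType.
Implicit Types (P U V : set (set X)) (A : set X).

Definition open_cover U : Prop := U `<=` open /\ cover U id = setT.

(* [set: X] is allowed as a member of U *)
Definition omega_cover U : Prop :=
  open_cover U /\
  (forall F : set X, finite_set F -> exists2 B, U B & F `<=` B).

Definition star A P : set X :=
  \bigcup_(B in [set B | P B /\ A `&` B !=set0]) B.

Definition locally_finite P : Prop :=
  forall x : X, exists2 N, nbhs x N &
    finite_set [set B | P B /\ N `&` B !=set0].

Definition refines V U : Prop :=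
  forall B, V B -> exists2 C, U C & B `<=` C.

End Covers.

(* no separation axiom is included *)
Definition paracompact (X : topologicalType) : Prop :=
  forall U : set (set X), open_cover U ->
    exists V : set (set X), [/\ open_cover V, refines V U & locally_finite V].

(* A two-player game of length omega with perfect information.  The innings
   are numbered from 0.  [legal1] gives the moves open to ONE, and [legal2 a]
   the answers open to TWO when ONE has just played [a]. *)
Record game : Type := Game {
  move1 : Type;
  move2 : Type;
  legal1 : set move1;
  legal2 : move1 -> set move2;
  won_by_TWO : (nat -> move1) -> (nat -> move2) -> Prop
}.

Section Strategies.
Variable G : game.

(* The answer at inning n is computed from ONE's moves 0, ..., n;
   [mkseq a n.+1] is [:: a 0; ...; a n]. *)
Definition play_of2 (tau : seq (move1 G) -> move2 G) (a : nat -> move1 G) :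
    nat -> move2 G :=
  fun n => tau (mkseq a n.+1).

(* ONE's move at inning n is computed from TWO's moves 0, ..., n - 1. *)
Definition play_of1 (sigma : seq (move2 G) -> move1 G) (b : nat -> move2 G) :
    nat -> move1 G :=
  fun n => sigma (mkseq b n).

(* A strategy must produce legal moves as long as the opponent does. *)
Definition strategy_ONE (sigma : seq (move2 G) -> move1 G) : Prop :=
  forall (b : nat -> move2 G) (n : nat),
    (forall i, (i < n)%N -> legal2 (play_of1 sigma b i) (b i)) ->
    legal1 (play_of1 sigma b n).

Definition strategy_TWO (tau : seq (move1 G) -> move2 G) : Prop :=
  forall (a : nat -> move1 G) (n : nat),
    (forall i, (i <= n)%N -> legal1 (a i)) ->
    legal2 (a n) (play_of2 tau a n).

Definition ONE_has_winning_strategy : Prop :=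
  exists2 sigma, strategy_ONE sigma &
    forall b : nat -> move2 G,
      (forall n, legal2 (play_of1 sigma b n) (b n)) ->
      ~ won_by_TWO (play_of1 sigma b) b.

Definition TWO_has_winning_strategy : Prop :=
  exists2 tau, strategy_TWO tau &
    forall a : nat -> move1 G,
      (forall n, legal1 (a n)) -> won_by_TWO a (play_of2 tau a).

End Strategies.

Definition equivalent_games (G H : game) : Prop :=
  (ONE_has_winning_strategy G <-> ONE_has_winning_strategy H) /\
  (TWO_has_winning_strategy G <-> TWO_has_winning_strategy H).

Definition Gufin (X : topologicalType) : game :=
  @Game (set (set X)) (set (set X))
    (@open_cover X)
    (fun U => [set V | finite_set V /\ V `<=` U])
    (fun _ V => omega_cover (range (fun n => cover (V n) id)) \/
                exists n, cover (V n) id = setT).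

Definition SGcomp (X : topologicalType) : game :=
  @Game (set (set X)) (set X)
    (@open_cover X)
    (fun _ => [set K | compact K])
    (fun U K => omega_cover (range (fun n => star (K n) (U n)))).

(* Main.v *)
From mathcomp Require Import all_boot all_order.
From mathcomp Require Import boolp classical_sets functions cardinality.
Require Import Defs.
From mathcomp Require Import topology.

(** A round of either game can be translated into a round of the other, inning
    by inning, with the current cover of ONE as the only input.
    If TWO picks a finite [V `<=` U], a finite (hence compact) set [K] meeting
    every nonempty member of [V] has a star in [U] containing the union of [V].
    Conversely, if ONE plays [U], replace it with a locally finite open
    refinement [P]; a compact [K] meets only finitely many members of [P], and
    choosing for each of them a member of [U] containing it gives a finite
    [V `<=` U] whose union contains the star of [K] in [P]. *)

Set Implicit Arguments.
Unset Strict Implicit.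
Unset Printing Implicit Defensive.

Local Open Scope classical_set_scope.

(* ONE's moves in [H] become moves in [G], and TWO's answers in [G] come back
   as answers in [H]; hence [H] is at least as favourable to TWO as [G]. *)
Definition game_translation (G H : game) (f : move1 H -> move1 G)
    (g : move1 H -> move2 G -> move2 H) : Prop :=
  [/\ forall a, legal1 a -> legal1 (f a),
      forall a b, legal1 a -> legal2 (f a) b -> legal2 a (g a b) &
      forall (a : nat -> move1 H) (b : nat -> move2 G),
        (forall n, legal1 (a n)) -> (forall n, legal2 (f (a n)) (b n)) ->
        won_by_TWO (fun n => f (a n)) b ->
        won_by_TWO a (fun n => g (a n) (b n))].

(** TWO runs [tau] on the translated moves of ONE and sends its answer back through [g]. The default
    [a0] of [last] is never reached in a play, since TWO always answers a nonempty history. *)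
Lemma game_translation_TWO (G H : game) (f : move1 H -> move1 G)
    (g : move1 H -> move2 G -> move2 H) (a0 : move1 H) :
  game_translation f g ->
  TWO_has_winning_strategy G -> TWO_has_winning_strategy H.
Proof.
move=> [f_legal g_legal fg_won] [tau tau_legal tau_wins].
pose tau' (s : seq (move1 H)) := g (last a0 s) (tau (map f s)).
have playE a : play_of2 tau' a =
    fun n => g (a n) (play_of2 tau (fun n => f (a n)) n).
  apply/funext => n; rewrite /play_of2 /tau' {1}mkseqS last_rcons.
  by rewrite /mkseq -map_comp.
exists tau' => [a n a_legal|a a_legal]; rewrite playE.
  apply: g_legal; first exact: a_legal.
  by apply: (tau_legal (fun n => f (a n))) => i /a_legal /f_legal.
apply: fg_won => //.
  by move=> n; apply: (tau_legal (fun n => f (a n))) => i _; exact: f_legal.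
by apply: tau_wins => n; exact: f_legal.
Qed.

(** The history is rebuilt recursively because [g] needs ONE's current move in [H], which is what
    [sigma] plays on the part already translated. *)
Definition translated_history (G H : game)
    (g : move1 H -> move2 G -> move2 H) (sigma : seq (move2 H) -> move1 H) :
    seq (move2 G) -> seq (move2 H) :=
  foldl (fun h b => rcons h (g (sigma h) b)) [::].

Lemma game_translation_ONE (G H : game) (f : move1 H -> move1 G)
    (g : move1 H -> move2 G -> move2 H) :
  game_translation f g ->
  ONE_has_winning_strategy H -> ONE_has_winning_strategy G.
Proof.
move=> [f_legal g_legal fg_won] [sigma sigma_legal sigma_wins].
pose hist := translated_history g sigma.
pose answer b n := g (sigma (hist (mkseq b n))) (b n).
have histE b n : hist (mkseq b n) = mkseq (answer b) n.
  elim: n => // n IHn.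
  by rewrite !mkseqS -IHn /hist /translated_history foldl_rcons.
(* Strong induction: [g] gives a legal answer only to a legal move, so legality at [n] rests on that
   of all earlier moves of [sigma]. *)
have legal1_n b n : (forall i, (i < n)%N ->
    legal2 (f (sigma (hist (mkseq b i)))) (b i)) ->
    legal1 (play_of1 sigma (answer b) n).
  elim/ltn_ind: n => n IHn b_legal; apply: sigma_legal => i lt_in.
  rewrite /play_of1 -histE; apply: g_legal; last exact: b_legal.
  rewrite histE; apply: IHn => // j lt_ji; apply: b_legal.
  exact: ltn_trans lt_ji lt_in.
exists (fun s => f (sigma (hist s))) => [b n b_legal|b b_legal b_won].
  by rewrite /play_of1 histE; apply/f_legal/legal1_n.
have legal_all n : legal1 (sigma (hist (mkseq b n))).
  by rewrite histE; apply: legal1_n => i _; exact: b_legal.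
have playE : play_of1 sigma (answer b) = fun n => sigma (hist (mkseq b n)).
  by apply/funext => n; rewrite histE.
apply: (sigma_wins (answer b)); rewrite playE.
  by move=> n; exact: g_legal (legal_all n) (b_legal n).
exact: fg_won legal_all b_legal b_won.
Qed.

Section StarsAndCovers.
Variable X : topologicalType.
Implicit Types (P U V : set (set X)) (A K : set X).

Lemma finite_star_cover V : finite_set V ->
  exists K, compact K /\ forall U, V `<=` U -> cover V id `<=` star K U.
Proof.
(* A point [x0] is needed as the value of the choice function at the empty set. *)
move=> finV; have [[x0 _]|X0] := pselect ([set: X] !=set0); last first.
  exists set0; split=> [|U _ x]; first exact: compact0.
  by exfalso; apply: X0; exists x.
have /choice[p pP] (B : set X) : exists x, B !=set0 -> B x.
  by have [[x Bx]|] := pselect (B !=set0); [exists x | exists x0].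
exists (p @` V); split=> [|U VU x [B VB Bx]].
  exact/finite_compact/finite_image.
exists B => //; split; first exact: VU.
by exists (p B); split; [exists B | apply: pP; exists x].
Qed.

Lemma compact_locally_finite P K : locally_finite P -> compact K ->
  finite_set [set B | P B /\ K `&` B !=set0].
Proof.
move=> lfP cK; apply: contrapT => infK.
(* If the claim fails, the sets leaving out of [K] a part that meets only
   finitely many members of [P] form a proper filter; local finiteness keeps
   it from clustering in [K]. *)
pose F : set_system X :=
  [set A | finite_set [set B | P B /\ (K `\` A) `&` B !=set0]].
have FF : ProperFilter F.
  split; first by rewrite /F /= setD0.
  split.
  - by rewrite /F /= setDT; apply: sub_finite_set (finite_set0 _) => B [_ [x [[]]]].
  - move=> A1 A2 F1 F2; have := conj F1 F2; rewrite /F /= -finite_setU.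
    apply: sub_finite_set => B [PB [x [[Kx nAx] Bx]]].
    have [A1x|nA1x] := pselect (A1 x); [right|left]; split => //; exists x => //.
    by split=> //; split=> // A2x; exact: nAx.
  - move=> A1 A2 sA; apply: sub_finite_set => B [PB [x [[Kx nAx] Bx]]].
    by split=> //; exists x; split=> //; split=> // /sA.
have FK : F K.
  by rewrite /F /= setDv; apply: sub_finite_set (finite_set0 _) => B [_ [x [[]]]].
have [x [Kx xF]] := cK F FF FK; have [N Nx finN] := lfP x.
(* What remains of [K] outside the complement of [N] lies in [N], which meets only finitely many
   members of [P]. *)
have FN : F (~` N).
  apply: sub_finite_set finN => B [PB [y [[_ nNy] By]]]; split=> //.
  by exists y; split=> //; exact: contrapT.
by have [y []] := xF _ _ FN Nx.
Qed.

Lemma compact_star_subcover P U K : refines P U -> locally_finite P ->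
  compact K ->
  exists V, [/\ finite_set V, V `<=` U & star K P `<=` cover V id].
Proof.
move=> PU lfP cK.
have /choice[c cP] (B : set X) : exists C, P B -> U C /\ B `<=` C.
  have [/PU[C UC BC]|nPB] := pselect (P B); first by exists C.
  by exists set0 => /nPB.
exists (c @` [set B | P B /\ K `&` B !=set0]); split.
- exact/finite_image/compact_locally_finite.
- by move=> _ [B [PB _] <-]; have [] := cP B PB.
- move=> x [B [PB KB] Bx]; exists (c B); first by exists B.
  by have [_] := cP B PB; apply.
Qed.

Lemma open_cover_union U V : open_cover U -> V `<=` U -> open (cover V id).
Proof. by move=> [oU _] VU; apply: bigcup_open => B /VU /oU. Qed.

Lemma open_star K U : open_cover U -> open (star K U).
Proof. by move=> [oU _]; apply: bigcup_open => B [/oU]. Qed.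

Lemma omega_cover_range (D : nat -> set X) : (forall n, open (D n)) ->
  (forall F : set X, finite_set F -> exists n, F `<=` D n) ->
  omega_cover (range D).
Proof.
move=> oD Dfin; split; first split.
- by move=> _ [n _ <-].
- rewrite -subTset => x _; have [n Dx] := Dfin _ (finite_set1 x).
  by exists (D n); [exists n | exact: Dx].
- by move=> F /Dfin[n FD]; exists (D n) => //; exists n.
Qed.

(** This carries a win from one game to the other: the translated answers capture at least as much
    in every inning. *)
Lemma omega_cover_range_sub (C D : nat -> set X) : (forall n, open (D n)) ->
  (forall n, C n `<=` D n) -> omega_cover (range C) -> omega_cover (range D).
Proof.
move=> oD CD [_ Cfin]; apply: omega_cover_range => // F /Cfin[_ [n _ <-] FC].
by exists n; exact: subset_trans FC (CD n).
Qed.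

Lemma Gufin_SGcomp_translation :
  exists (f : move1 (SGcomp X) -> move1 (Gufin X))
         (g : move1 (SGcomp X) -> move2 (Gufin X) -> move2 (SGcomp X)),
    game_translation f g.
Proof.
have /choice[k kP] V : exists K, finite_set V ->
    compact K /\ forall U, V `<=` U -> cover V id `<=` star K U.
  have [/finite_star_cover[K KP]|nfV] := pselect (finite_set V); first by exists K.
  by exists set0 => /nfV.
exists id, (fun _ => k); split=> //= [U V _ [/kP[]]//|U V U_cover V_legal].
have VU n : cover (V n) id `<=` star (k (V n)) (U n).
  by have [/kP[_ k_star] sVU] := V_legal n; exact: k_star.
have o_star n : open (star (k (V n)) (U n)) by exact: open_star.
case=> [|[n Vn]]; first exact: omega_cover_range_sub.
(* If one union is already the whole space, the star of that inning contains every finite set. *)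
by apply: omega_cover_range => // F _; exists n => x _; apply: VU; rewrite Vn.
Qed.

Lemma SGcomp_Gufin_translation : paracompact X ->
  exists (f : move1 (Gufin X) -> move1 (SGcomp X))
         (g : move1 (Gufin X) -> move2 (SGcomp X) -> move2 (Gufin X)),
    game_translation f g.
Proof.
move=> pX.
have /choice[r rP] U : exists P, open_cover U ->
    [/\ open_cover P, refines P U & locally_finite P].
  have [/pX[P PP]|nU] := pselect (open_cover U); first by exists P.
  by exists set0 => /nU.
(* Choice is made over pairs, as the finite family depends on both the cover and the compact set;
   illegal pairs get the empty family. *)
have /choice[v vP] (UK : set (set X) * set X) : exists V,
    open_cover UK.1 -> compact UK.2 ->
    [/\ finite_set V, V `<=` UK.1 & star UK.2 (r UK.1) `<=` cover V id].
  have [[U_cover cK]|nUK] := pselect (open_cover UK.1 /\ compact UK.2).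
  - have [_ PU lfP] := rP _ U_cover.
    by have [V VP] := compact_star_subcover PU lfP cK; exists V.
  by exists set0 => U_cover cK; exfalso; apply: nUK.
exists r, (fun U K => v (U, K)); split=> /= [U /rP[]//|U K U_cover cK|U K U_cover cK].
  by have [] := vP (U, K) U_cover cK.
move=> K_won; left; apply: omega_cover_range_sub K_won => n;
  have [_ VU starV] := vP (U n, K n) (U_cover n) (cK n) => //.
exact: open_cover_union (U_cover n) VU.
Qed.

End StarsAndCovers.

Theorem theorem3p18 (X : topologicalType) (hX : paracompact X) :
  equivalent_games (Gufin X) (SGcomp X).
Proof.
have [f [g fg]] := Gufin_SGcomp_translation X.
have [f' [g' fg']] := SGcomp_Gufin_translation hX.
split; split.
(* Winning strategies of TWO travel along a translation, those of ONE against it, so each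
   translation serves once for each player. *)
- exact: game_translation_ONE fg'.
- exact: game_translation_ONE fg.
(* Here [set0] only inhabits the type of moves; it need not be a cover. *)
- exact: (game_translation_TWO (set0 : move1 (SGcomp X)) fg).
- exact: (game_translation_TWO (set0 : move1 (Gufin X)) fg').
Qed.
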